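(* Let $\eta_2=1$ and $\eta_d=\frac12$ for all integers $d\geq 3$. For all integers $d\geq 2$ and $k\geq 1$, we have \[N_{d\text{-ary}}^{\mathrm{non}}(k)\geq \eta_d\left((k+1)\left\lceil\log_2(k+1)\right\rceil-2^{\left\lceil\log_2(k+1)\right\rceil}+1\right).\]
   Context: Let $d\geq 2$ be an integer. A $d$-ary plane tree is either an empty tree or a root vertex with $d$ subtrees that are linearly ordered from left to right and are themselves $d$-ary plane trees (the subtrees of a vertex may be empty). The $i$-th subtree of a vertex is the $i$-th from the left; an edge has type $i$ if it connects a vertex to the root of its $i$-th subtree. For a vertex $u$, let $\chi(u)$ be the set of $i\in\{1,\dots,d\}$ such that the $i$-th subtree of $u$ is nonempty. Let $e$ be an edge of type $i$ connecting $u$ to its child $v$. Contracting $e$ (merging $v$ into $u$, all other edges keeping their types, so that the merged vertex has nonempty subtrees in the positions $(\chi(u)\setminus\{i\})\cup\chi(v)$) is a legal contraction if every element of $\chi(u)\setminus\{i\}$ that is smaller than $i$ is strictly smaller than $\min(\chi(v))$ and every element of $\chi(u)\setminus\{i\}$ that is greater than $i$ is strictly greater than $\max(\chi(v))$; this condition is vacuous if $v$ is a leaf. The result of a legal contraction is again a $d$-ary plane tree. A $d$-ary plane tree $\mathcal T$ noncontiguously contains a $d$-ary plane tree $T$ if $T$ can be obtained from $\mathcal T$ by a (possibly empty) sequence of legal edge contractions. $N_{d\text{-ary}}^{\mathrm{non}}(k)$ denotes the minimum number of vertices in a $d$-ary plane tree that noncontiguously contains every $d$-ary plane tree with $k$ vertices.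 *)

(* Defs.v *)
From mathcomp Require Import all_boot all_order all_algebra.
From mathcomp Require Import boolp.
From Stdlib Require Import Relation_Operators.

Set Implicit Arguments.
Unset Strict Implicit.
Unset Printing Implicit Defensive.

Import Order.TTheory GRing.Theory Num.Theory.

(* The positions 1, ..., d of the subtrees are encoded as 0, ..., d - 1. *)
Inductive dtree (d : nat) : Type :=
| Empty
| Node of {ffun 'I_d -> dtree d}.

Arguments Empty {d}.

Definition nonempty (d : nat) (t : dtree d) : bool :=
  if t is Node _ then true else false.

Fixpoint nvertices (d : nat) (t : dtree d) : nat :=
  if t is Node f then (sumn (codom (fun i => nvertices (f i)))).+1 else 0.

(* A vertex is represented by the family f of its subtrees. *)
Definition chi (d : nat) (f : {ffun 'I_d -> dtree d}) : {set 'I_d} :=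
  [set i | nonempty (f i)].

(* Comparing with every m in chi g amounts to comparing with the minimum
   (resp. maximum) of chi g, and is vacuous if chi g is empty. *)
Definition legal (d : nat) (f : {ffun 'I_d -> dtree d}) (i : 'I_d)
    (g : {ffun 'I_d -> dtree d}) : Prop :=
  forall j, j \in chi f :\ i ->
    (j < i -> forall m, m \in chi g -> j < m) /\
    (i < j -> forall m, m \in chi g -> m < j).

(* When the contraction is legal, chi f :\ i and chi g are disjoint, so the
   order of the two tests is irrelevant. *)
Definition merge_child (d : nat) (f : {ffun 'I_d -> dtree d}) (i : 'I_d)
    (g : {ffun 'I_d -> dtree d}) : {ffun 'I_d -> dtree d} :=
  [ffun j => if j \in chi f :\ i then f j else g j].

Definition replace_subtree (d : nat) (f : {ffun 'I_d -> dtree d}) (i : 'I_d)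
    (t : dtree d) : {ffun 'I_d -> dtree d} :=
  [ffun j => if j == i then t else f j].

Inductive legal_contraction (d : nat) : dtree d -> dtree d -> Prop :=
| contract_root_edge (f g : {ffun 'I_d -> dtree d}) (i : 'I_d) :
    f i = Node g -> legal f i g ->
    legal_contraction (Node f) (Node (merge_child f i g))
| contract_in_subtree (f : {ffun 'I_d -> dtree d}) (i : 'I_d) (t : dtree d) :
    legal_contraction (f i) t ->
    legal_contraction (Node f) (Node (replace_subtree f i t)).

Definition noncontiguously_contains (d : nat) : dtree d -> dtree d -> Prop :=
  clos_refl_trans (dtree d) (@legal_contraction d).

Definition universal (d k : nat) (U : dtree d) : Prop :=
  forall T : dtree d, nvertices T = k -> noncontiguously_contains U T.

Fixpoint complete_tree (d h : nat) : dtree d :=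
  if h is h'.+1 then Node [ffun _ => complete_tree d h'] else Empty.

Lemma contains_in_subtree (d : nat) (s t : dtree d) (f : {ffun 'I_d -> dtree d})
    (i : 'I_d) :
  f i = s -> noncontiguously_contains s t ->
  noncontiguously_contains (Node f) (Node (replace_subtree f i t)).
Proof.
move=> fi st; elim: st f fi => {s t} [s t st|s|s t u _ IH1 _ IH2] f fi.
- by apply: rt_step; apply: contract_in_subtree; rewrite fi.
- have -> : replace_subtree f i s = f.
    by apply/ffunP => j; rewrite ffunE; case: eqP => // ->.
  exact: rt_refl.
- apply: rt_trans (IH1 f fi) _.
  have -> : replace_subtree f i u = replace_subtree (replace_subtree f i t) i u.
    by apply/ffunP => j; rewrite !ffunE; case: eqP.
  by apply: IH2; rewrite ffunE eqxx.
Qed.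

Lemma contains_delete_leaf (d : nat) (f : {ffun 'I_d -> dtree d}) (i : 'I_d) :
  f i = Node [ffun _ => Empty] ->
  noncontiguously_contains (Node f) (Node (replace_subtree f i Empty)).
Proof.
move=> fi; apply: rt_step.
have -> : replace_subtree f i Empty = merge_child f i [ffun _ => Empty].
  apply/ffunP => j; rewrite !ffunE !inE; case: eqP => //= _.
  by case: (f j).
apply: contract_root_edge fi _ => j _.
by split=> _ m; rewrite inE ffunE.
Qed.

Lemma nvertices_subtree (d : nat) (f : {ffun 'I_d -> dtree d}) (i : 'I_d) :
  nvertices (f i) < nvertices (Node f).
Proof.
by rewrite /= ltnS sumnE big_image /= (bigD1 i) //= leq_addr.
Qed.

Lemma complete_tree_contains (d h : nat) (t : dtree d) :
  nonempty t -> nvertices t <= h ->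
  noncontiguously_contains (complete_tree d h) t.
Proof.
elim: h t => [|h IH] [|f] // _ le_fh.
have sub_h i : nvertices (f i) <= h.
  by rewrite -ltnS; apply: leq_trans (nvertices_subtree f i) _.
pose g (s : seq 'I_d) : {ffun 'I_d -> dtree d} :=
  [ffun j => if j \in s then f j else complete_tree d h].
have key s : uniq s ->
    noncontiguously_contains (complete_tree d h.+1) (Node (g s)).
  elim: s => [_|i s IHs /= /andP[i_s uniq_s]].
    have -> : g [::] = [ffun _ => complete_tree d h].
      by apply/ffunP => j; rewrite !ffunE.
    exact: rt_refl.
  apply: rt_trans (IHs uniq_s) _.
  have -> : g (i :: s) = replace_subtree (g s) i (f i).
    by apply/ffunP => j; rewrite !ffunE inE; case: eqP => //= ->.
  have gi : g s i = complete_tree d h by rewrite ffunE (negPf i_s).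
  case fi: (f i) => [|f'].
    case: (posnP h) => [h0|h_gt0].
      have -> : replace_subtree (g s) i Empty = g s.
        by apply/ffunP => j; rewrite ffunE; case: eqP => // ->; rewrite gi h0.
      exact: rt_refl.
    have leaf_h : noncontiguously_contains (complete_tree d h)
        (Node [ffun _ => Empty]).
      apply: IH => //=; rewrite sumnE big_image /= big1 // => j _.
      by rewrite ffunE.
    apply: rt_trans (contains_in_subtree gi leaf_h) _.
    have -> : replace_subtree (g s) i Empty =
        replace_subtree (replace_subtree (g s) i (Node [ffun _ => Empty]))
          i Empty.
      by apply/ffunP => j; rewrite !ffunE; case: eqP.
    by apply: contains_delete_leaf; rewrite ffunE eqxx.
  by apply: contains_in_subtree gi _; apply: IH => //; rewrite -fi.
have -> : f = g (enum 'I_d) by apply/ffunP => j; rewrite ffunE mem_enum.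
exact/key/enum_uniq.
Qed.

Lemma universal_exists (d k : nat) :
  exists n, `[< exists2 U : dtree d, nvertices U = n & universal k U >].
Proof.
exists (nvertices (complete_tree d k)); apply/asboolP.
exists (complete_tree d k) => // -[|f] kE; last first.
  by apply: complete_tree_contains; rewrite // kE.
by rewrite -kE; exact: rt_refl.
Qed.

(* ex_minn is the least element of a nonempty set of natural numbers. *)
Definition Nnon (d k : nat) : nat := ex_minn (universal_exists d k).

Definition eta (d : nat) : rat := if d == 2 then 1%R else (1 / 2%:R)%R.

(* Main.v *)
Require Import Defs.
From mathcomp Require Import all_boot all_order all_algebra.
From mathcomp Require Import boolp zify lra.

Set Implicit Arguments.
Unset Strict Implicit.
Unset Printing Implicit Defensive.

(** The bound comes from counting points of a finite ordered set that realizes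
    every layered order (an ordinal sum of antichains) of a given size.

    Order side.  Let a strictly ordered set A realize all layered orders with
    n points, and let D be an antichain of maximal size in A, so that D has at
    least n points.  Every other point of A lies above or below some point of
    D, and never both.  If p + q = n, the ordinal sum of a layered order with
    q points that the part below D does not realize and one with p points that
    the part above D does not realize would not be realized by A.  Hence the
    parts above and below D realize all layered orders with a and with b
    points, for some a + b = n - 1, and the size of A is at least n plus the
    sizes of two sets of the same kind.  Unfolding t times
    ([realizes_all_card]) gives (n + 1) t - 2 ^ t + 1 <= #|A| for every t;
    the theorem uses t = up_log 2 (n + 1), which is the best choice.

    Tree side.  The vertices of a binary tree with left subtree L, root r and
    right subtree R are ordered so that L lies below r and below R, while r is
    incomparable to R.  Homeomorphic embeddings of binary trees, which send
    left and right subtrees of a vertex into the left and right subtrees of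
    its image, preserve this order and incomparability.  A left spine from
    which right chains hang is a layered order; hence a binary tree with N
    vertices into which all such combs with k vertices embed satisfies
    N >= (k + 1) t - 2 ^ t + 1.

    For a d-ary tree U, [dembeds U t] describes a way of finding the binary
    tree t in U that survives when legal contractions are undone.  It can be
    turned into an embedding into a binary tree having as many vertices as U
    if d = 2 and at most twice as many in general, whence the factor eta. *)

(** * Layered orders realized by a finite ordered set *)

(** A list c encodes the layered order whose layers, from the top down, have
    x + 1 points for x in c: shifting by one rules out empty layers, which
    would not separate the layers around them. *)
Definition weight (c : seq nat) : nat := sumn (map S c).

Section StrictOrder.

Variables (P : finType) (lt : rel P).
Hypothesis lt_irr : irreflexive lt.
Hypothesis lt_trans : transitive lt.

Definition antichain (X : {set P}) : bool :=
  [forall x in X, forall y in X, ~~ lt x y].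

Definition all_below (X A : {set P}) : {set P} :=
  [set y in A | [forall x in X, lt y x]].

Fixpoint realizes (c : seq nat) (A : {set P}) : bool :=
  if c is x :: c' then
    [exists X : {set P}, [&& X \subset A, antichain X, #|X| == x.+1
                           & realizes c' (all_below X A)]]
  else true.

Definition realizes_all (n : nat) (A : {set P}) : Prop :=
  forall c, weight c = n -> realizes c A.

Lemma antichainP (X : {set P}) :
  reflect {in X &, forall x y, ~~ lt x y} (antichain X).
Proof.
apply: (iffP 'forall_in_forall_inP) => H; first by move=> x y /H; apply.
by move=> x xX y yX; apply: H.
Qed.

Lemma realizesS (c : seq nat) (A B : {set P}) :
  A \subset B -> realizes c A -> realizes c B.
Proof.
elim: c A B => [|x c IH] A B //= AB /existsP[X /and4P[XA acX cX cA]].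
apply/existsP; exists X; rewrite (subset_trans XA AB) acX cX /=.
apply: IH cA; apply/subsetP => y; rewrite !inE => /andP[yA ->].
by rewrite (subsetP AB).
Qed.

Lemma realizes_drop (m c : seq nat) (A : {set P}) :
  realizes (m ++ c) A -> realizes c A.
Proof.
elim: m A => [|x m IH] A //= /existsP[X /and4P[_ _ _ /IH]].
by apply: realizesS; apply/subsetP => y; rewrite inE => /andP[].
Qed.

Definition above_of (D A : {set P}) := [set y in A | [exists d in D, lt d y]].
Definition below_of (D A : {set P}) := [set y in A | [exists d in D, lt y d]].

(** Follow the layers of m from the top.  If they all lie above D, then m is
    realized above D.  Otherwise some layer has a point that is at most a point
    of D, and everything under that layer, c included, lies below D. *)
Lemma realizes_split (D A B : {set P}) (m c : seq nat) :
  (forall y, y \in A ->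
     [|| y \in D, y \in above_of D A | y \in below_of D A]) ->
  B \subset A -> realizes (m ++ c) B ->
  realizes m (B :&: above_of D A) \/ realizes c (B :&: below_of D A).
Proof.
move=> covA; elim: m B => [|x m IH] B BA /=; first by left.
case/existsP => X /and4P[XB acX cX mcB].
have subBA : all_below X B \subset A.
  by apply: subset_trans BA; apply/subsetP => y; rewrite inE => /andP[].
have [Xabove|] := boolP (X \subset above_of D A).
  case: (IH _ subBA mcB) => [mB|cB]; [left|right].
    apply/existsP; exists X; rewrite acX cX subsetI XB Xabove /=.
    apply: realizesS mB; apply/subsetP => y; rewrite !inE.
    by case/andP => /andP[-> ->] ->.
  apply: realizesS cB; apply/setSI/subsetP => y.
  by rewrite inE => /andP[].
case/subsetPn => z zX zNabove; right.
apply: realizesS (realizes_drop mcB).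
apply/subsetP => y; rewrite inE => /andP[yB /forall_inP/(_ z zX) lt_yz].
rewrite !inE yB (subsetP BA) //=; apply/exists_inP.
have := covA z (subsetP BA z (subsetP XB z zX)).
rewrite (negPf zNabove) /= => /orP[zD|]; first by exists z.
rewrite inE => /andP[_ /exists_inP[d dD lt_zd]]; exists d => //.
exact: lt_trans lt_zd.
Qed.

(** By [realizes_split], for each p + q = n + 1 the part below D realizes all
    layered orders of size p or the part above D all those of size q.  Take
    for b the last p before the first alternative fails. *)
Lemma realizes_all_split (D A : {set P}) (n : nat) :
  (forall y, y \in A ->
     [|| y \in D, y \in above_of D A | y \in below_of D A]) ->
  realizes_all n.+1 A ->
  exists a b, [/\ a + b = n, realizes_all a (above_of D A)
                & realizes_all b (below_of D A)].
Proof.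
move=> covA unA.
suff H p : p <= n -> realizes_all p (below_of D A) \/
    exists a b, [/\ a + b = n, realizes_all a (above_of D A)
                & realizes_all b (below_of D A)].
  case: (H n (leqnn n)) => // Hn; exists 0, n; split=> //.
  by case.
elim: p => [|p IH] p_n; first by left; case.
case: (IH (ltnW p_n)) => [Hp|]; last by right.
have [HS|] := EM (realizes_all p.+1 (below_of D A)); first by left.
move=> nHS; right; exists (n - p), p; split => //; first by rewrite subnK // ltnW.
move=> m wm; apply: contrapT => nm; apply: nHS => c wc.
have wmc : weight (m ++ c) = n.+1.
  by rewrite /weight map_cat sumn_cat -!/(weight _) wm wc; lia.
case: (realizes_split covA (subxx A) (unA _ wmc)) => /realizesS H.
  by case: nm; apply: H; apply: subsetIr.
by apply: H; apply: subsetIr.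
Qed.

(** Keeping t as a parameter, instead of the optimal up_log 2 (n + 1), makes
    the induction linear: both parts of A are bounded with the same t - 1, and
    their sizes a and b enter only through a + b. *)
Lemma realizes_all_card (t n : nat) (A : {set P}) :
  realizes_all n A -> n.+1 * t + 1 <= 2 ^ t + #|A|.
Proof.
elim: t n A => [|t IH] [|n] A unA; rewrite ?expn0 ?muln0 ?add0n ?leq_addr //.
  have := ltn_expl t.+1 (isT : 1 < 2); lia.
(* A single layer of n + 1 points is an antichain. *)
have /existsP[X0 /and4P[X0A acX0 /eqP cX0 _]] : realizes [:: n] A.
  by apply: unA; rewrite /weight /= addn0.
pose good (X : {set P}) := (X \subset A) && antichain X.
have goodX0 : good X0 by rewrite /good X0A.
case: (arg_maxnP (fun X : {set P} => #|X|) goodX0) => D /andP[DA acD] maxD.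
have cD : n < #|D| by rewrite -cX0; apply: maxD.
move/antichainP: acD => acD.
have covA y : y \in A ->
     [|| y \in D, y \in above_of D A | y \in below_of D A].
  move=> yA; apply/negP => /negP; rewrite !negb_or => /and3P[yD yNa yNb].
  have /maxD : good (y |: D).
    rewrite /good subUset sub1set yA DA; apply/antichainP => u v.
    rewrite !inE => /orP[/eqP->|uD] /orP[/eqP->|vD].
    - by rewrite lt_irr.
    - by apply: contraNN yNb => yv; rewrite inE yA; apply/exists_inP; exists v.
    - by apply: contraNN yNa => yv; rewrite inE yA; apply/exists_inP; exists u.
    - exact: acD.
  by rewrite cardsU1 yD add1n /= leqNgt ltnSn.
have [a [b [abn /IH Ha /IH Hb]]] := realizes_all_split covA unA.
have disj : [disjoint D & above_of D A :|: below_of D A].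
  rewrite disjoints_subset; apply/subsetP => y yD; rewrite !inE.
  apply/norP; split; apply/nandP; right; apply/exists_inP => -[d dD];
    by apply/negP; apply: acD.
have disj' : [disjoint above_of D A & below_of D A].
  rewrite disjoints_subset; apply/subsetP => y; rewrite !inE.
  case/andP=> _ /exists_inP[d dD dy].
  apply/nandP; right; apply/exists_inP => -[e eD ye].
  by have /negP[] := acD d e dD eD; apply: lt_trans ye.
have : #|D| + (#|above_of D A| + #|below_of D A|) <= #|A|.
  move: disj disj'; rewrite -!leq_card_setU => /eqP H1 /eqP H2.
  rewrite -H2 -H1; apply: subset_leq_card.
  rewrite !subUset DA; apply/andP; split=> //; apply/andP.
  by split; apply/subsetP => y; rewrite inE => /andP[].
by rewrite expnS; nia.
Qed.

End StrictOrder.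

Lemma realizes_imset (P Q : finType) (ltP : rel P) (ltQ : rel Q) (e : P -> Q)
    (c : seq nat) (A : {set P}) :
  injective e -> (forall x y, ltQ (e x) (e y) = ltP x y) ->
  realizes ltP c A -> realizes ltQ c (e @: A).
Proof.
move=> e_inj e_lt; elim: c A => [|x c IH] A //=.
case/existsP => X /and4P[XA /antichainP acX cX cA].
apply/existsP; exists (e @: X); rewrite imsetS // card_imset // cX /=.
apply/andP; split.
  by apply/antichainP => _ _ /imsetP[u uX ->] /imsetP[v vX ->]; rewrite e_lt acX.
apply: realizesS (IH _ cA); apply/subsetP => _ /imsetP[y yB ->].
move: yB; rewrite !inE => /andP[yA /forall_inP yX]; rewrite imset_f //=.
by apply/forall_inP => _ /imsetP[u uX ->]; rewrite e_lt yX.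
Qed.

(** * The layered orders contained in a binary tree *)

Inductive btree : Type := BEmpty | BNode of btree & btree.

Fixpoint bsize (t : btree) : nat :=
  if t is BNode l r then (bsize l + bsize r).+1 else 0.

(** Homeomorphic embedding of t into the host u, which comes first because the
    recursion is on the host. *)
Fixpoint bembeds (u t : btree) : Prop :=
  match t, u with
  | BEmpty, _ => True
  | BNode _ _, BEmpty => False
  | BNode a b, BNode l r =>
      [\/ bembeds l t, bembeds r t | bembeds l a /\ bembeds r b]
  end.

Definition rchain (x : nat) : btree := iter x (BNode BEmpty) BEmpty.

(** The tree whose vertices, ordered as in [plt], form the layered order
    encoded by c: each vertex of the left spine makes up a layer together with
    the chain that hangs on its right. *)
Fixpoint comb (c : seq nat) : btree :=
  if c is x :: c' then BNode (comb c') (rchain x) else BEmpty.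

Lemma bsize_comb (c : seq nat) : bsize (comb c) = weight c.
Proof.
have rchainE x : bsize (rchain x) = x by elim: x => //= x ->.
by elim: c => //= x c ->; rewrite rchainE /weight /= addnC.
Qed.

Fixpoint points (u : btree) : finType :=
  if u is BNode l r then (points l + option (points r))%type else void.

(** Label the vertices so that each root exceeds its descendants and each right
    subtree exceeds the left one, and list the labels by in-order traversal:
    this is the usual bijection from binary trees to 231-avoiding
    permutations, and [plt] holds when both position and label increase.  The
    root is inr None. *)
Fixpoint plt (u : btree) : rel (points u) :=
  match u return rel (points u) with
  | BEmpty => fun _ _ => false
  | BNode l r => fun x y =>
      match x, y with
      | inl x, inl y => plt x y
      | inl _, inr _ => true
      | inr (Some x), inr (Some y) => plt x y
      | _, _ => false
      end
  end.

Lemma plt_irr (u : btree) : irreflexive (@plt u).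
Proof. by elim: u => [[]|l IHl r IHr] /= [x|[x|]] //=. Qed.

Lemma plt_trans (u : btree) : transitive (@plt u).
Proof.
elim: u => [[]|l IHl r IHr] /= [y|[y|]] [x|[x|]] [z|[z|]] //=.
- exact: IHl.
- exact: IHr.
Qed.

Lemma card_points (u : btree) : #|points u| = bsize u.
Proof.
elim: u => [|l IHl r IHr] /=; first by rewrite card_void.
by rewrite card_sum card_option IHl IHr addnS.
Qed.

(** When the comb embeds at the root of u, the top layer consists of that root
    and of a chain in the right subtree, which is an antichain incomparable to
    the root; the other layers are in the left subtree, below both. *)
Lemma bembeds_realizes (u : btree) (c : seq nat) :
  bembeds u (comb c) -> realizes (@plt u) c setT.
Proof.
elim: u c => [|l IHl r IHr] [|x c] // emb_c.
have ltl (a b : points l) :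
  @plt (BNode l r) (inl a) (inl b) = plt a b by [].
have ltr (a b : points r) :
  @plt (BNode l r) (inr (Some a)) (inr (Some b)) = plt a b by [].
have injl : injective (inl : points l -> points (BNode l r)).
  by move=> a b [].
have injr : injective (inr \o some : points r -> points (BNode l r)).
  by move=> a b [].
have fromr c' : bembeds r (comb c') ->
    realizes (@plt (BNode l r)) c' ((inr \o some) @: setT).
  by move/IHr; apply: realizes_imset.
have froml c' : bembeds l (comb c') ->
    realizes (@plt (BNode l r)) c' (inl @: setT).
  by move/IHl; apply: realizes_imset.
case: emb_c => [/froml|/fromr|[/froml cl xr]].
- exact/realizesS/subsetT.
- exact/realizesS/subsetT.
(* A chain of x.+1 vertices is the comb of the one-layer order [:: x]. *)
have [Y [acY cY]] : exists Y : {set points r}, antichain (@plt r) Y /\ #|Y| = x.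
  case: x xr => [|x] xr.
    by exists set0; rewrite cards0; split=> //; apply/antichainP => ?; rewrite inE.
  have /existsP[Y /and4P[_ acY /eqP cY _]] := IHr [:: x] xr.
  by exists Y.
pose X : {set points (BNode l r)} := inr @: (None |: some @: Y).
have some_inj : injective (@Some (points r : Type)) by move=> ? ? [].
have inr_inj : injective (inr : _ -> points (BNode l r)) by move=> ? ? [].
apply/existsP; exists X; rewrite subsetT /=; apply/and3P; split.
- apply/antichainP => _ _ /imsetP[u uX ->] /imsetP[v vX ->].
  move: uX vX; rewrite !inE => /orP[/eqP->|/imsetP[a aY ->]] //.
  by case/orP => [/eqP->|/imsetP[b bY ->]] //; apply: (antichainP _ _ acY).
- rewrite card_imset // cardsU1 card_imset // cY.
  by rewrite (_ : None \notin _) //; apply/imsetP => -[].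
apply: realizesS cl; apply/subsetP => _ /imsetP[y _ ->].
by rewrite !inE; apply/forall_inP => _ /imsetP[z _ ->].
Qed.

Lemma bembeds_all_size (u : btree) (k t : nat) :
  (forall s, bsize s = k -> bembeds u s) -> k.+1 * t + 1 <= 2 ^ t + bsize u.
Proof.
move=> unu; rewrite -card_points -cardsT.
apply: (realizes_all_card (@plt_irr u) (@plt_trans u)) => c wc.
by apply/bembeds_realizes/unu; rewrite bsize_comb.
Qed.

(** * Binary trees contained in a d-ary tree *)

Lemma dtree_induction (d : nat) (Q : dtree d -> Prop) :
  Q Empty -> (forall f : {ffun 'I_d -> dtree d}, (forall i, Q (f i)) -> Q (Node f)) ->
  forall t, Q t.
Proof.
move=> Q0 QN; fix IH 1 => -[|f]; first exact: Q0.
by apply: QN => i; apply: IH.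
Qed.

Lemma nvertices_Node (d : nat) (f : {ffun 'I_d -> dtree d}) :
  nvertices (Node f) = (\sum_i nvertices (f i)).+1.
Proof. by rewrite /= sumnE big_image. Qed.

(** The vertices of U contracted into one vertex of t may be spread over
    several levels of U, so the two subtrees of this vertex can come from any
    two positions i < j, not only the first and the last.  Allowing all pairs
    is what makes the relation stable under undoing a contraction. *)
Fixpoint dembeds (d : nat) (U : dtree d) (t : btree) : Prop :=
  match t, U with
  | BEmpty, _ => True
  | BNode _ _, Empty => False
  | BNode a b, Node f =>
      (exists i, dembeds (f i) t) \/
      (exists i j : 'I_d, [/\ i < j, dembeds (f i) a & dembeds (f j) b])
  end.

Lemma dembedsE (d : nat) (U : dtree d) : dembeds U BEmpty.
Proof. by case: U. Qed.

Lemma dembeds_child (d : nat) (f : {ffun 'I_d -> dtree d}) i t :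
  dembeds (f i) t -> dembeds (Node f) t.
Proof. by case: t => // a b fi; left; exists i. Qed.

(** When the child g at position i has been merged into the root f, two
    positions j < l of the merged vertex that come one from f and one from g,
    both with nonempty subtrees, are handled by legality: the position from f
    lies on the same side of i as of the position from g, so that i can replace
    the latter. *)
Lemma dembeds_contraction (d : nat) (U V : dtree d) (t : btree) :
  legal_contraction U V -> dembeds V t -> dembeds U t.
Proof.
move=> UV; elim: UV t => {U V} [f g i fi leg|f i s _ IH] [|a b] //=.
- pose h := merge_child f i g.
  have gsub t j : dembeds (g j) t -> dembeds (f i) t.
    by rewrite fi; apply: dembeds_child.
  have hP j : (j \in chi f :\ i /\ h j = f j) \/ h j = g j.
    by rewrite /h ffunE; case: ifP => [|_]; [left|right].
  have chiP j t : t <> BEmpty -> dembeds (g j) t -> j \in chi g.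
    by rewrite inE; case: (g j); case: t.
  case=> [[j hj]|[j [l [jl hja hlb]]]].
    move: hj; rewrite -/(h j); case: (hP j) => [[_ ->]|-> /(gsub (BNode a b))].
      by left; exists j.
    by left; exists i.
  move: hja hlb; rewrite -/(h j) -/(h l).
  case: (hP j) (hP l) => [[jf ->]|->] [[lf ->]|->] ja lb.
  + by right; exists j, l.
  + case: b lb => [|b1 b2] lb; first by right; exists j, l; split=> //; exact: dembedsE.
    have lg : l \in chi g by apply: chiP lb.
    right; exists j, i; split=> //; last exact: gsub lb.
    have [_ /(_ _ l lg)] := leg j jf.
    by move: jf; rewrite !inE -(inj_eq val_inj) /= => /andP[]; lia.
  + case: a ja => [|a1 a2] ja; first by right; exists j, l; split=> //; exact: dembedsE.
    have jg : j \in chi g by apply: chiP ja.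
    right; exists i, l; split=> //; first last.
      exact: gsub ja.
    have [/(_ _ j jg) + _] := leg l lf.
    by move: lf; rewrite !inE -(inj_eq val_inj) /= => /andP[]; lia.
  + left; exists i; rewrite fi; right; exists j, l; split=> //.
have rep j t : dembeds (replace_subtree f i s j) t -> dembeds (f j) t.
  by rewrite ffunE; case: eqP => // -> /IH.
case=> [[j /rep]|[j [l [jl /rep ja /rep lb]]]]; first by left; exists j.
by right; exists j, l.
Qed.

Lemma dembeds_contains (d : nat) (U V : dtree d) (t : btree) :
  noncontiguously_contains U V -> dembeds V t -> dembeds U t.
Proof.
elim=> {U V} [U V UV||U V W _ IHUV _ IHVW /IHVW/IHUV] //.
exact: dembeds_contraction UV.
Qed.

(** A binary tree seen as a d-ary tree using the first and last positions. *)
Fixpoint dtree_of (d : nat) (t : btree) : dtree d :=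
  if t is BNode a b then
    Node [ffun i : 'I_d => if i == 0 :> nat then dtree_of d a else
                    if i == d.-1 :> nat then dtree_of d b else Empty]
  else Empty.

Lemma dembeds_dtree_of (d : nat) (t : btree) :
  1 < d -> dembeds (dtree_of d t) t.
Proof.
case: d => [|[|d]] // _; elim: t => //= a IHa b IHb.
right; exists ord0, ord_max; rewrite !ffunE /= eqxx; split=> //.
Qed.

Lemma nvertices_dtree_of (d : nat) (t : btree) :
  1 < d -> nvertices (dtree_of d t) = bsize t.
Proof.
case: d => [|[|d]] // _; elim: t => [|a IHa b IHb] //; rewrite [dtree_of _ _]/=.
rewrite nvertices_Node big_ord_recl big_ord_recr /= !ffunE /= IHa big1.
  by rewrite add0n /bump /= add1n eqxx IHb.
by move=> i _; rewrite ffunE /= /bump /= add1n eqSS ltn_eqF.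
Qed.

Lemma universal_dembeds (d k : nat) (U : dtree d) (t : btree) :
  1 < d -> universal k U -> bsize t = k -> dembeds U t.
Proof.
move=> d1 unU st; apply: (dembeds_contains (unU (dtree_of d t) _)).
  by rewrite nvertices_dtree_of.
exact: dembeds_dtree_of.
Qed.

(** * Embedding into a binary tree of controlled size *)

Fixpoint btree_of_2tree (U : dtree 2) : btree :=
  if U is Node f then BNode (btree_of_2tree (f ord0)) (btree_of_2tree (f ord_max))
  else BEmpty.

Lemma bsize_btree_of_2tree (U : dtree 2) : bsize (btree_of_2tree U) = nvertices U.
Proof.
elim/dtree_induction: U => // f IH; rewrite nvertices_Node /= !IH.
by rewrite big_ord_recr big_ord1; congr ((nvertices (f _) + _).+1); apply/val_inj.
Qed.

Lemma dembeds_btree_of_2tree (U : dtree 2) (t : btree) :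
  dembeds U t -> bembeds (btree_of_2tree U) t.
Proof.
elim/dtree_induction: U t => [|f IH] [|a b] //=.
have I2 (i : 'I_2) : i = ord0 \/ i = ord_max.
  by case: i => [[|[|]] // H]; [left|right]; apply/val_inj.
case=> [[i]|[i [j [ij ia jb]]]].
  by case: (I2 i) => -> /IH; [constructor 1|constructor 2].
constructor 3; move: ij ia jb.
by case: (I2 i) (I2 j) => -> [] -> // _ /IH ? /IH.
Qed.

(** The nonempty trees g i hang to the left of a right chain, in the order of
    s, so that an earlier one and a later one are separated by a vertex. *)
Definition join_children (d : nat) (g : 'I_d -> btree) (s : seq 'I_d) : btree :=
  foldr (fun i u => if g i is BNode _ _ then BNode (g i) u else u) BEmpty s.

Lemma bembeds_empty (u : btree) : bembeds u BEmpty.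
Proof. by case: u. Qed.

Lemma bembeds_join_child (d : nat) (g : 'I_d -> btree) (s : seq 'I_d) i t :
  i \in s -> bembeds (g i) t -> bembeds (join_children g s) t.
Proof.
case: t => [|a b]; first by move=> *; apply: bembeds_empty.
elim: s => //= j s IHs; rewrite inE => /orP[/eqP<-|/IHs IH /IH].
  by case: (g i) => // l r; constructor 1.
by case: (g j) => // l r; constructor 2.
Qed.

(** If a is nonempty, the chain vertex to which g i is attached has g j in its
    right subtree.  The additional root serves when a is empty, for then the
    chain vertices on the left of g j may all be missing. *)
Lemma bembeds_join_children (d : nat) (g : 'I_d -> btree) (s : seq 'I_d)
    (i j : 'I_d) a b :
  sorted (fun x y : 'I_d => x < y) s -> i \in s -> j \in s -> i < j ->
  bembeds (g i) a -> bembeds (g j) b ->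
  bembeds (BNode BEmpty (join_children g s)) (BNode a b).
Proof.
move=> srt si sj ij ga gb.
case: a ga => [|a1 a2] ga.
  by constructor 3; split=> //; apply: bembeds_join_child gb.
constructor 2; elim: s srt si sj => //= l s IHs.
rewrite path_sortedE => [/andP[/allP ls srt]|y x z]; last exact: ltn_trans.
rewrite !inE => /orP[/eqP <-|si] /orP[/eqP jl|sj].
- by move: ij; rewrite jl ltnn.
- case: (g i) ga => // l' r' ga; constructor 3; split=> //.
  exact: bembeds_join_child gb.
- by have := ltn_trans (ls i si) ij; rewrite jl ltnn.
- by case: (g l) => [|l' r']; [|constructor 2]; apply: IHs.
Qed.

Fixpoint btree_of_dtree (d : nat) (U : dtree d) : btree :=
  if U is Node f then
    BNode BEmpty (join_children (fun i => btree_of_dtree (f i)) (enum 'I_d))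
  else BEmpty.

(** A vertex with m children yields m + 1 vertices: itself and one for each
    edge to a child.  A nonempty tree with n vertices thus yields 2 n - 1. *)
Lemma bsize_btree_of_dtree (d : nat) (U : dtree d) :
  bsize (btree_of_dtree U) + nonempty U <= 2 * nvertices U.
Proof.
elim/dtree_induction: U => // f IH; rewrite nvertices_Node /= -big_enum /=.
elim: (enum 'I_d) => [|i s IHs]; first by rewrite big_nil.
by rewrite big_cons /=; case: (f i) (IH i) => [|h] /=; lia.
Qed.

Lemma dembeds_btree_of_dtree (d : nat) (U : dtree d) (t : btree) :
  dembeds U t -> bembeds (btree_of_dtree U) t.
Proof.
elim/dtree_induction: U t => [|f IH] [|a b] //.
case=> [[i it]|[i [j [ij ia jb]]]].
  by constructor 2; apply: bembeds_join_child (IH i _ it); rewrite mem_enum.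
apply: bembeds_join_children ij (IH _ _ ia) (IH _ _ jb); rewrite ?mem_enum //.
by have := iota_ltn_sorted 0 d; rewrite -val_enum_ord sorted_map.
Qed.

Import Order.TTheory GRing.Theory Num.Theory.

Local Open Scope ring_scope.

Theorem theorem2p2 (d k : nat) (hd : (2 <= d)%N) (hk : (1 <= k)%N) :
  eta d * (k.+1%:R * (up_log 2 k.+1)%:R - 2 ^+ up_log 2 k.+1 + 1)
    <= (Nnon d k)%:R.
Proof.
set t := up_log 2 k.+1.
rewrite /Nnon; case: ex_minnP => n /asboolP[U <- unU] _.
have unE s := universal_dembeds hd unU (t := s).
have size_bound : (eta d = 1 /\ (k.+1 * t + 1 <= 2 ^ t + nvertices U)%N) \/
    (eta d = 1 / 2%:R /\ (k.+1 * t + 1 <= 2 ^ t + 2 * nvertices U)%N).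
  rewrite /eta; case: eqP => [d2|_]; [left|right]; split=> //.
    move: U {unU} unE; rewrite d2 => U unE; rewrite -bsize_btree_of_2tree.
    by apply: bembeds_all_size => s /unE; apply: dembeds_btree_of_2tree.
  apply: leq_trans (leq_add (leqnn _) (bsize_btree_of_dtree U)).
  rewrite addnA; apply: leq_trans (leq_addr _ _).
  by apply: bembeds_all_size => s /unE; apply: dembeds_btree_of_dtree.
have castR (m : nat) : (k.+1 * t + 1 <= 2 ^ t + m)%N ->
    k.+1%:R * t%:R - 2 ^+ t + 1 <= m%:R :> rat.
  by rewrite -(ler_nat rat) !natrD natrM natrX; lra.
case: size_bound => -[-> /castR]; rewrite ?natrM; lra.
Qed.
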